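(* Let $d\ge1$, $k\ge1$, and let $\lambda_1,\dots,\lambda_k$ be positive constants. Let $\{N_1(A),\ A\in\mathcal{A}_d\},\dots,\{N_k(A),\ A\in\mathcal{A}_d\}$ be $k$ mutually independent non-negative integer valued random measures. Then the following are equivalent: (1) for every $k'\in\{1,\dots,k\}$, the random measure $\{\sum_{j=1}^{k'}jN_j(A),\ A\in\mathcal{A}_d\}$ is a generalized Poisson random field $GPRF\{\lambda_j\}_{1\le j\le k'}$; (2) $\{N_1(A),\ A\in\mathcal{A}_d\},\dots,\{N_k(A),\ A\in\mathcal{A}_d\}$ are mutually independent Poisson random fields with rate parameters $\lambda_1,\dots,\lambda_k$, respectively.
   Context: $\mathbb{R}_+=[0,\infty)$, and $\mathcal{A}_d$ is the collection of bounded axis-parallel rectangles (products of $d$ bounded intervals) in $\mathbb{R}^d_+$; $|A|$ is the Lebesgue measure of $A$. A non-negative integer valued random measure $\{M(A),\ A\in\mathcal{A}_d\}$ is a random (locally finite, $\mathbb{N}_0$-valued) measure on $\mathbb{R}^d_+$ evaluated on rectangles. Poisson random field (PRF) with rate $\lambda>0$: a non-negative integer valued random measure $\{N(A),\ A\in\mathcal{A}_d\}$ such that $N(A)$ is Poisson distributed with mean $\lambda|A|$ for each $A\in\mathcal{A}_d$, and $N(A_1),\dots,N(A_m)$ are independent for any finite collection of disjoint $A_1,\dots,A_m\in\mathcal{A}_d$. Generalized Poisson random field $GPRF\{\lambda_j\}_{1\le j\le k}$ (with $\lambda_1,\dots,\lambda_k>0$): a non-negative integer valued random measure $\{M(A),\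 A\in\mathcal{A}_d\}$ such that for each $A\in\mathcal{A}_d$ $$\Pr\{M(A)=n\}=\sum_{(n_1,\dots,n_k)\in\Theta(k,n)}\ \prod_{j=1}^{k}\frac{(\lambda_j|A|)^{n_j}}{n_j!}e^{-\lambda_j|A|},\quad n\ge0,$$ where $\Theta(k,n)=\{(n_1,\dots,n_k)\in\mathbb{N}_0^k:\sum_{j=1}^k jn_j=n\}$, and $M(A_1),\dots,M(A_m)$ are independent for any disjoint $A_1,\dots,A_m\in\mathcal{A}_d$. *)

(* Defs.v *)
From HB Require Import structures.
From mathcomp Require Import all_boot all_order all_algebra.
From mathcomp Require Import all_classical all_reals all_analysis.

Set Implicit Arguments.
Unset Strict Implicit.
Unset Printing Implicit Defensive.

Import Order.TTheory GRing.Theory Num.Theory.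
Import numFieldNormedType.Exports.

Local Open Scope classical_set_scope.
Local Open Scope ring_scope.

(* Indices are shifted: the coordinate [j : 'I_k] stands for n_{j+1}. *)
Definition Theta (k n : nat) : set {ffun 'I_k -> nat} :=
  [set v | (\sum_(j < k) j.+1 * v j)%N = n].
Arguments Theta : clear implicits.

Section Rectangles.
Variables (R : realType) (d : nat).

(* [box I] ranges over the bounded rectangles of R_+^d as [I] ranges over the
   families satisfying [bounded_nonneg]; the sides may be open, half-open,
   closed, degenerate or empty. *)
Definition bounded_nonneg (I : 'I_d -> interval R) : Prop :=
  exists b : R, forall i, [set` I i] `<=` `[0, b].

Definition box (I : 'I_d -> interval R) : set (d.-tuple R) :=
  [set x | forall i, tnth x i \in I i].

Definition rectangles : set (set (d.-tuple R)) :=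
  [set box I | I in [set I | bounded_nonneg I]].

(* d-dimensional Lebesgue measure of [box I]: the product of the lengths of
   its sides, which are finite when [bounded_nonneg I] holds. *)
Definition volume (I : 'I_d -> interval R) : R :=
  \prod_(i < d) fine (lebesgue_measure [set` I i]).

Definition orthant : set (d.-tuple R) := [set x | forall i, 0 <= tnth x i].

End Rectangles.

Section Independence.
Context (dT : measure_display) (T : measurableType dT) (R : realType).
Variable P : probability T R.

Definition independent_classes (I : finType) (F : I -> set (set T)) : Prop :=
  forall (J : {set I}) (E : I -> set T),
    (forall i, i \in J -> F i (E i)) ->
    P (\bigcap_(i in [set` J]) E i) = (\prod_(i in J) P (E i))%E.

Definition independent_rvs (I : finType) (X : I -> T -> nat) : Prop :=
  independent_classes (fun i => preimage_set_system setT (X i) measurable).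

End Independence.

(* A field [M] is indexed by sets, [M A w] being the value at the outcome [w]
   of the random variable attached to [A]; only its values at rectangles are
   ever used. *)
Section Fields.
Context (dT : measure_display) (T : measurableType dT) (R : realType).
Variables (P : probability T R) (d : nat).
Implicit Type M : set (d.-tuple R) -> T -> nat.

(* Each realisation is the restriction to the rectangles of a measure on
   R_+^d, encoded as a measure on R^d carried by the orthant; being finite on
   rectangles, it is locally finite. *)
Definition random_measure M : Prop :=
  (forall A, rectangles A -> measurable_fun setT (M A)) /\
  (forall w, exists mu : {measure set (d.-tuple R) -> \bar R},
      mu (~` @orthant R d) = 0%E /\
      forall A, rectangles A -> mu A = (M A w)%:R%:E).

Definition field_sigma_algebra M : set (set T) :=
  <<s \bigcup_(A in @rectangles R d) preimage_set_system setT (M A) measurable >>.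

Definition independent_fields (k : nat)
    (N : 'I_k -> set (d.-tuple R) -> T -> nat) : Prop :=
  independent_classes P (fun j => field_sigma_algebra (N j)).

Definition independent_on_disjoint M : Prop :=
  forall (m : nat) (A : 'I_m -> set (d.-tuple R)),
    (forall i, rectangles (A i)) -> trivIset setT A ->
    independent_rvs P (fun i => M (A i)).

(* The [nat] argument of the library's [poisson_prob] is unused; for mean 0,
   [poisson_prob] is the Dirac mass at 0. *)
Definition PRF (lam : R) M : Prop :=
  [/\ random_measure M,
      forall I, bounded_nonneg I -> forall U : set nat,
        P (M (box I) @^-1` U) = poisson_prob (lam * volume I) 0%N U
    & independent_on_disjoint M].

(* [Theta k n] is finite (each coordinate is at most n), so the [fsbig] sum is
   the genuine one. *)
Definition GPRF (k : nat) (lam : 'I_k -> R) M : Prop :=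
  [/\ random_measure M,
      forall I, bounded_nonneg I -> forall n : nat,
        P [set w | M (box I) w = n] =
        (\sum_(v \in Theta k n) \prod_(j < k)
            ((lam j * volume I) ^+ v j / (v j)`!%:R
             * expR (- (lam j * volume I))))%:E
    & independent_on_disjoint M].

End Fields.

(* Main.v *)
Require Import Defs.
From HB Require Import structures.
From mathcomp Require Import all_boot all_order all_algebra.
From mathcomp Require Import all_classical all_reals all_analysis.

(* Fix disjoint rectangles A_1, ..., A_m. By independence of the fields, the
   joint mass function of (sum_(j <= k') j N_j(A_i))_i at n is the sum, over the
   matrices v of natural numbers with sum_j j v_ij = n_i, of the product over j
   of the joint masses of (N_j(A_i))_i at column j. Expanding the product over i
   of the GPRF masses gives the same sum with Poisson masses, whence (2) => (1).
   Conversely, this mixture can be deconvolved one j at a time: evaluated at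
   n = j u, it involves the law of N_j(A_.) at u with the nonzero factor
   P(N_l(A_.) = 0 for l < j), and otherwise only laws of index l < j and the
   law of N_j(A_.) at vectors of smaller total. *)

Set Implicit Arguments.
Unset Strict Implicit.
Unset Printing Implicit Defensive.

Import Order.TTheory GRing.Theory Num.Theory.

Local Open Scope classical_set_scope.
Local Open Scope ring_scope.

(** * Mixtures over count matrices and their deconvolution *)

Section Mixtures.
Variables (R : realFieldType) (K m : nat).

(* [v i j] counts the points of [N_(j+1)] in [A_i]; under the hypothesis
   [forall i, n i <= B], the bound [B] on the entries loses no matrix. *)
Definition count_matrices (B : nat) (n : 'I_m -> nat) :
    pred {ffun 'I_m -> {ffun 'I_K -> 'I_B.+1}} :=
  [pred v : {ffun 'I_m -> {ffun 'I_K -> 'I_B.+1}} |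
    [forall i, (\sum_(j < K) j.+1 * v i j)%N == n i]].

Definition mixture (B : nat) (b : 'I_K -> ('I_m -> nat) -> R)
    (n : 'I_m -> nat) : R :=
  \sum_(v in @count_matrices B n) \prod_(j < K) b j (fun i => v i j).

(** Expanding the product of sums picks one vector of [Theta K (n i)] for each row [i], hence a
    matrix; the products over rows and columns then commute. *)
Lemma prod_Theta_mixture (B : nat) (p : 'I_K -> 'I_m -> nat -> R)
    (n : 'I_m -> nat) : (forall i, n i <= B)%N ->
  \prod_(i < m) (\sum_(v \in Theta K (n i)) \prod_(j < K) p j i (v j)) =
  mixture B (fun j v => \prod_(i < m) p j i (v i)) n.
Proof.
move=> nB.
have Theta_bounded i : \sum_(v \in Theta K (n i)) \prod_(j < K) p j i (v j) =
    \sum_(v : {ffun 'I_K -> 'I_B.+1} | (\sum_(j < K) j.+1 * v j)%N == n i)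
      \prod_(j < K) p j i (v j).
  pose h (v : {ffun 'I_K -> 'I_B.+1}) : {ffun 'I_K -> nat} := [ffun j => v j : nat].
  have h_inj : injective h.
    by move=> u v /ffunP huv; apply/ffunP => j; apply/val_inj; move: (huv j); rewrite !ffunE.
  pose D := [pred v : {ffun 'I_K -> 'I_B.+1} | (\sum_(j < K) j.+1 * v j)%N == n i].
  rewrite (@fsbigE _ _ _ _ _ [seq h v | v <- enum D]).
  - rewrite big_map big_enum_cond /=; apply: eq_big => v.
      apply/andP/idP => [[]//|vn]; split=> //; apply/mem_set.
      by rewrite /Theta /= -(eqP vn); apply: eq_bigr => j _; rewrite ffunE.
    by move=> _; apply: eq_bigr => j _; rewrite ffunE.
  - by rewrite map_inj_uniq ?enum_uniq.
  - move=> w /= /mapP[v]; rewrite mem_enum inE => /eqP vn ->.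
    by rewrite /Theta /= -vn; apply: eq_bigr => j _; rewrite ffunE.
  - move=> v; rewrite /Theta /= => vn /negP[]; apply/mapP.
    (* Every weight [j.+1] is at least 1, so an entry is at most [n i <= B]; hence [h] reaches all
       of [Theta K (n i)]. *)
    have vB j : (v j < B.+1)%N.
      rewrite ltnS (leq_trans _ (nB i)) // -vn (bigD1 j) //=.
      by rewrite (leq_trans _ (leq_addr _ _)) // leq_pmull.
    exists [ffun j => Ordinal (vB j)]; last first.
      by apply/ffunP => j; rewrite !ffunE.
    by rewrite mem_enum inE; apply/eqP; rewrite -vn; apply: eq_bigr => j _; rewrite ffunE.
rewrite (eq_bigr _ (fun i _ => Theta_bounded i)) bigA_distr_big_dep.
apply: eq_big => [v|v _]; last by rewrite exchange_big.
by rewrite inE; apply/familyP/forallP => vn i; exact: (vn i).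
Qed.

End Mixtures.

(* Evaluate both mixtures at [(K + 1) u]: the only matrix whose last column
   does not precede [u] is the one with last column [u] and zeros elsewhere. *)
Lemma mixture_inj_last (R : realFieldType) (K m : nat)
    (b c : 'I_K.+1 -> ('I_m -> nat) -> R) :
  (forall j, j != ord_max -> b j = c j) ->
  (forall j, c j (fun=> 0%N) != 0) ->
  (forall B n, (forall i, n i <= B)%N -> mixture B b n = mixture B c n) ->
  b ord_max = c ord_max.
Proof.
move=> bc c0 mix; apply/funext => u.
have [s] := ubnP (\sum_(i < m) u i)%N; elim: s u => // s IHs u; rewrite ltnS => us.
pose n i := (K.+1 * u i)%N; pose B := (\sum_(i < m) n i)%N.
have nB i : (n i <= B)%N by rewrite /B (bigD1 i) //= leq_addr.
have uB i : (u i < B.+1)%N by rewrite ltnS (leq_trans _ (nB i)) // leq_pmull.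
pose v0 : {ffun 'I_m -> {ffun 'I_K.+1 -> 'I_B.+1}} :=
  [ffun i => [ffun j => if j == ord_max then Ordinal (uB i) else ord0]].
have v0n : v0 \in @count_matrices K.+1 m B n.
  rewrite inE; apply/forallP => i; rewrite (bigD1 ord_max) //= big1.
    by rewrite !ffunE eqxx addn0.
  by move=> j /negPf jmax; rewrite !ffunE jmax muln0.
have := mix B n nB; rewrite /mixture (bigD1 v0) //= [RHS](bigD1 v0) //=.
rewrite [X in _ + X = _](_ : _ = \sum_(v in count_matrices n | v != v0)
    \prod_(j < K.+1) c j (fun i => v i j)); last first.
  apply: eq_bigr => v /andP[+ vv0]; rewrite inE => /forallP vn.
  apply: eq_bigr => j _; have [->|/bc -> //] := eqVneq j ord_max.
  (* The last column has weight [K.+1], so it is bounded by [u]. If its total is that of [u], it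
     uses up all of [n], the other entries vanish and [v] is [v0]; otherwise induction applies. *)
  have vu i : (v i ord_max <= u i)%N.
    have /eqP := vn i; rewrite (bigD1 ord_max) //= /n => vni.
    by rewrite -(leq_pmul2l (ltn0Sn K)) -vni leq_addr.
  apply: IHs; rewrite (leq_trans _ us) // ltn_neqAle leq_sum ?andbT //.
  apply: contra vv0 => /eqP vus.
  have vui i : v i ord_max = u i :> nat.
    apply/eqP; rewrite eqn_leq vu /= leqNgt; apply/negP => vlt.
    move: vus; rewrite (bigD1 i) //= [RHS](bigD1 i) //= => vus.
    suff: (v i ord_max + \sum_(i0 < m | i0 != i) v i0 ord_max <
           u i + \sum_(i0 < m | i0 != i) u i0)%N by rewrite vus ltnn.
    by rewrite -addSn leq_add // leq_sum.
  apply/eqP/ffunP => i; apply/ffunP => j'; apply/val_inj; rewrite !ffunE.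
  case: eqVneq => [->|jmax] //=.
  have /eqP := vn i; rewrite (bigD1 ord_max) //= vui /n => /eqP.
  rewrite -[X in _ == X]addn0 eqn_add2l sum_nat_eq0 => /forallP/(_ j').
  by rewrite jmax muln_eq0 => /eqP.
(* The remainders coincide and cancel. In the [v0] term that is left, all factors but the last are
   values of [c] at zero, hence nonzero. *)
move=> /addIr; rewrite (bigD1 ord_max) //= [RHS](bigD1 ord_max) //=.
rewrite [X in _ * X = _](_ : _ =
    \prod_(j < K.+1 | j != ord_max) c j (fun i => v0 i j)); last first.
  by apply: eq_bigr => j /bc ->.
have -> : (fun i => nat_of_ord (v0 i ord_max)) = u.
  by apply/funext => i; rewrite !ffunE eqxx.
apply: mulIf; apply/prodf_neq0 => j /negPf jmax.
rewrite [X in c j X](_ : _ = fun=> 0%N) ?c0 //.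
by apply/funext => i; rewrite !ffunE jmax.
Qed.

(** * Laws and independence of integer-valued random variables *)

Lemma measurable_preimage_nat (d : measure_display) (T : measurableType d)
    (X : T -> nat) (U : set nat) :
  measurable_fun setT X -> measurable (X @^-1` U).
Proof. by move=> mX; rewrite -[X in measurable X]setTI; exact: mX. Qed.

(** Countable additivity over the singletons of [U]. Two general measures are allowed, to cover
    restricted or rescaled probabilities and the comparison with [poisson_prob]. *)
Lemma measure_preimage_nat_ext (d d' : measure_display)
    (S : measurableType d) (T : measurableType d') (R : realType)
    (mu : {measure set S -> \bar R}) (nu : {measure set T -> \bar R})
    (X : S -> nat) (Y : T -> nat) :
  measurable_fun setT X -> measurable_fun setT Y ->
  (forall n, mu (X @^-1` [set n]) = nu (Y @^-1` [set n])) ->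
  forall U, mu (X @^-1` U) = nu (Y @^-1` U).
Proof.
move=> mX mY munu U.
have triv A (Z : A -> nat) : trivIset U (fun n => Z @^-1` [set n]).
  by move=> i j _ _ [x [/= -> ->]].
rewrite -[U]image_id -bigcup_imset1 !preimage_bigcup !measure_bigcup //=;
  first exact: eq_eseriesr.
all: by move=> i _; exact: measurable_preimage_nat.
Qed.

Section Probability.
Context (dT : measure_display) (T : measurableType dT) (R : realType).
Variable P : probability T R.

Lemma independent_rvs_pmf (I : finType) (X : I -> T -> nat) :
  (forall i, measurable_fun setT (X i)) ->
  (forall v : I -> nat, P [set w | forall i, X i w = v i] =
     (\prod_i P [set w | X i w = v i])%E) ->
  independent_rvs P X.
Proof.
move=> mX PX.
(* Singletons are relaxed to arbitrary sets one coordinate at a time; [s] lists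
   the coordinates already relaxed. *)
have PXU (s : seq I) (U : I -> set nat) :
    (forall i, i \notin s -> exists n, U i = [set n]) ->
    P (\bigcap_i (X i @^-1` U i)) = (\prod_i P (X i @^-1` U i))%E.
  elim: s U => [|i0 s IHs] U Us.
    have /choice[v Uv] i := Us i isT.
    have -> : U = fun i => [set v i] by apply/funext.
    rewrite -PX; congr (P _); apply/seteqP; split=> w /=.
      by move=> wv i; exact: wv.
    by move=> wv i _; exact: wv.
  pose B := \bigcap_(i in [set i | i != i0]) (X i @^-1` U i).
  have mB : measurable B.
    apply: fin_bigcap_measurable; first exact: finite_finset.
    by move=> i _; exact: measurable_preimage_nat.
  pose c := \prod_(i | i != i0) fine (P (X i @^-1` U i)).
  have c0 : 0 <= c by apply: prodr_ge0 => i _; exact: fine_ge0.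
  have cE : c%:E = (\prod_(i | i != i0) P (X i @^-1` U i))%E.
    rewrite -prodEFin; apply: eq_bigr => i _; rewrite fineK //.
    by apply: fin_num_measure; exact: measurable_preimage_nat.
  have capE V : \bigcap_i (X i @^-1` (if i == i0 then V else U i)) =
      (X i0 @^-1` V) `&` B.
    apply/seteqP; split=> w /= => [wV|[wV wB] i _].
      split=> [|i /negPf ii0]; first by have := wV i0 Logic.I; rewrite eqxx.
      by have := wV i Logic.I; rewrite ii0.
    by case: eqVneq => [->//|ii0]; exact: wB.
  have prodE V : (\prod_i P (X i @^-1` (if i == i0 then V else U i)) =
      c%:E * P (X i0 @^-1` V))%E.
    rewrite (bigD1 i0) //= eqxx cE muleC; congr (_ * _)%E.
    by apply: eq_bigr => i /negPf ->.
  have UE : U = fun i => if i == i0 then U i0 else U i.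
    by apply/funext => i; case: eqVneq => [->|].
  (* As functions of the set at coordinate [i0], the two sides come from [P] restricted to [B] and
     [P] scaled by [c]; the induction hypothesis matches them on singletons. *)
  rewrite UE capE prodE.
  apply: (@measure_preimage_nat_ext _ _ _ _ _ (mrestr P mB)
    (mscale (NngNum c0) P) _ _ (mX i0) (mX i0)) => n.
  rewrite -[LHS]/(P (X i0 @^-1` [set n] `&` B)).
  rewrite -[RHS]/(c%:E * P (X i0 @^-1` [set n]))%E -capE -prodE.
  apply: IHs => i is0; case: eqVneq => ii0; first by exists n.
  by apply: Us; rewrite inE negb_or ii0.
move=> J E EJ.
(* Coordinates outside [J] receive [setT], whose preimage has probability 1, so both sides extend to
   the full index type. *)
have /choice[U UE] i : exists U : set nat,
    if i \in J then E i = X i @^-1` U else U = setT.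
  have [iJ|iJ] := boolP (i \in J); last by exists setT.
  by have [U _ <-] := EJ i iJ; exists U; rewrite setTI.
transitivity (P (\bigcap_i (X i @^-1` U i))).
  congr (P _); apply/seteqP; split=> w /= wE i.
    by move=> _; have := UE i; case: ifPn => iJ; [move=> <-; exact: wE|move=> ->].
  by move=> iJ; have := UE i; rewrite iJ => ->; exact: wE.
rewrite (PXU (enum I)); last by move=> i; rewrite mem_enum.
rewrite [RHS]big_mkcond /=; apply: eq_bigr => i _.
have := UE i; case: ifPn => iJ; first by move=> ->.
by move=> ->; rewrite preimage_setT probability_setT.
Qed.

Lemma independent_rvs_joint_pmf (I : finType) (X : I -> T -> nat)
    (v : I -> nat) : independent_rvs P X ->
  P [set w | forall i, X i w = v i] = (\prod_i P [set w | X i w = v i])%E.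
Proof.
move=> /(_ [set: I]%SET (fun i => X i @^-1` [set v i])) PX.
transitivity (P (\bigcap_(i in [set` [set: I]%SET]) X i @^-1` [set v i])).
  congr (P _); apply/seteqP; split=> w /= wv i; first by move=> _; exact: wv.
  by apply: wv; rewrite /= inE.
rewrite PX; first by apply: eq_bigl => i; rewrite inE.
by move=> i _; exists [set v i]; rewrite ?setTI.
Qed.

(** Split the event according to the matrix of values of the [Y j i]: the pieces are disjoint, and
    finitely many since entries are at most [B]. *)
Lemma mixture_pmf (K m B : nat) (Y : 'I_K -> 'I_m -> T -> nat)
    (b : 'I_K -> ('I_m -> nat) -> R) (n : 'I_m -> nat) :
  (forall j i, measurable_fun setT (Y j i)) ->
  (forall v : 'I_K -> 'I_m -> nat,
     P [set w | forall j i, Y j i w = v j i] = (\prod_j b j (v j))%:E) ->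
  (forall i, n i <= B)%N ->
  P [set w | forall i, (\sum_(j < K) j.+1 * Y j i w)%N = n i] =
  (mixture B b n)%:E.
Proof.
move=> mY Yb nB.
pose D := @count_matrices K m B n.
pose E (v : {ffun 'I_m -> {ffun 'I_K -> 'I_B.+1}}) :=
  [set w | forall j i, Y j i w = v i j].
transitivity (P (\bigcup_(v in [set` D]) E v)).
  congr (P _); apply/seteqP; split=> w /=; last first.
    move=> [v]; rewrite /= inE => /forallP vn wv i; rewrite -(eqP (vn i)).
    by apply: eq_bigr => j _; rewrite wv.
  move=> wn.
  have YB i j : (Y j i w < B.+1)%N.
    rewrite ltnS (leq_trans _ (nB i)) // -wn (bigD1 j) //=.
    by rewrite (leq_trans _ (leq_addr _ _)) // leq_pmull.
  exists [ffun i => [ffun j => Ordinal (YB i j)]]; last first.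
    by move=> j i; rewrite !ffunE.
  rewrite /= inE; apply/forallP => i; rewrite -wn; apply/eqP.
  by apply: eq_bigr => j _; rewrite !ffunE.
rewrite measure_fin_bigcup; first last.
- move=> v _; rewrite /E.
  rewrite (_ : [set w | _] = \bigcap_j \bigcap_i (Y j i @^-1` [set (v i j : nat)])).
    apply: fin_bigcap_measurable => [|j _]; first exact: finite_finset.
    apply: fin_bigcap_measurable => [|i _]; first exact: finite_finset.
    exact: measurable_preimage_nat.
  by apply/seteqP; split=> w /= wv j; [move=> _ i _; exact: wv|move=> i; exact: wv].
- move=> u v _ _ [w [/= wu wv]]; apply/ffunP => i; apply/ffunP => j.
  by apply/val_inj; rewrite /= -wu -wv.
- exact: finite_finset.
rewrite (fsbigE (enum D)) ?enum_uniq //; first last.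
- by move=> v /= vD; rewrite mem_enum => /negP[]; exact: vD.
- by move=> v /=; rewrite mem_enum.
rewrite big_enum_cond /mixture -sumEFin; apply: eq_big => v.
  by apply/andP/idP => [[]//|vD]; split=> //; exact/mem_set.
by move=> _; rewrite -Yb.
Qed.

End Probability.

(** * Poisson masses and weighted sums of measures *)

Definition poisson_mass (R : realType) (x : R) (n : nat) : R :=
  x ^+ n / n`!%:R * expR (- x).

Lemma poisson_prob_set1 (R : realType) (x : R) (n : nat) : 0 <= x ->
  poisson_prob x 0%N [set n] = (poisson_mass x n)%:E.
Proof.
rewrite le_eqVlt /poisson_prob => /predU1P[<-|x_gt0].
  (* Mean 0 arises from boxes of zero volume: [poisson_prob] is then the Dirac mass at 0, and the
     formula agrees because [0 ^+ 0 = 1]. *)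
  rewrite ltxx diracE /poisson_mass oppr0 expR0 mulr1 expr0n.
  by case: n => [|n]; [rewrite mem_set ?fact0 ?divr1|rewrite memNset ?mul0r].
rewrite x_gt0 esum_set1 /poisson_pmf ?x_gt0 // lee_fin.
by rewrite mulr_ge0 ?expR_ge0 // divr_ge0 // exprn_ge0 // ltW.
Qed.

Lemma poisson_mass0_neq0 (R : realType) (x : R) : poisson_mass x 0 != 0.
Proof. by rewrite /poisson_mass expr0 fact0 divr1 mul1r gt_eqF // expR_gt0. Qed.

Lemma volume_ge0 (R : realType) (d : nat) (I : 'I_d -> interval R) :
  0 <= volume I.
Proof. by apply: prodr_ge0 => i _; exact/fine_ge0/measure_ge0. Qed.

(** Supplies the measure behind each realisation of a weighted sum of fields. *)
Lemma weighted_sum_measure (dS : measure_display) (S : sigmaRingType dS)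
    (R : realType) (I : eqType) (s : seq I) (c : I -> nat)
    (mu : I -> {measure set S -> \bar R}) :
  exists nu : {measure set S -> \bar R},
    forall A, nu A = (\sum_(i <- s) (c i)%:R%:E * mu i A)%E.
Proof.
elim: s => [|i s [nu nuE]]; first by exists mzero => A; rewrite big_nil.
exists (measure_add (mscale (NngNum (ler0n R (c i))) (mu i)) nu) => A.
by rewrite [LHS]measure_addE nuE big_cons.
Qed.

(** * Joint masses of random fields on disjoint boxes *)

Section Fields.
Context (dT : measure_display) (T : measurableType dT) (R : realType).
Variables (P : probability T R) (d : nat).

Lemma random_measure_sum (K : nat) (c : 'I_K -> nat)
    (N : 'I_K -> set (d.-tuple R) -> T -> nat) :
  (forall j, random_measure (N j)) ->
  random_measure (fun A w => \sum_(j < K) c j * N j A w)%N.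
Proof.
move=> Nrm; split=> [A rA|w].
  elim: (index_enum 'I_K) => [|j s IHs].
    by under eq_fun do rewrite big_nil; exact: measurable_cst.
  under eq_fun do rewrite big_cons.
  apply: measurable_realfun.measurable_fun_addn => //.
  exact: (measurableT_comp (f := muln (c j))) ((Nrm j).1 A rA).
have /choice[mu muN] j := (Nrm j).2 w.
have [nu nuE] := weighted_sum_measure (index_enum 'I_K) c mu.
exists nu; split=> [|A rA].
  by rewrite nuE big1 // => j _; rewrite (muN j).1 mule0.
rewrite nuE natr_sum -sumEFin; apply: eq_bigr => j _.
by rewrite (muN j).2 // -EFinM -natrM.
Qed.

(** The event attached to [j] lies in the sigma-algebra of [N (f j)], so independence applies along
    the image of [f]. Later [f] embeds the first [K] indices. *)
Lemma independent_fields_joint_pmf (k K m : nat) (f : 'I_K -> 'I_k)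
    (N : 'I_k -> set (d.-tuple R) -> T -> nat) (A : 'I_m -> set (d.-tuple R))
    (v : 'I_K -> 'I_m -> nat) :
  injective f -> independent_fields P N -> (forall i, rectangles (A i)) ->
  P [set w | forall j i, N (f j) (A i) w = v j i] =
  (\prod_j P [set w | forall i, N (f j) (A i) w = v j i])%E.
Proof.
move=> f_inj Nind rA.
(* Quantifying over the preimages of [l] avoids inverting [f]; by injectivity [E (f j)] constrains
   only [v j]. *)
pose E l := [set w | forall j, f j = l -> forall i, N l (A i) w = v j i].
have Ef j : E (f j) = [set w | forall i, N (f j) (A i) w = v j i].
  by apply/seteqP; split=> w /= => [/(_ j erefl)//|wv _ /f_inj ->].
transitivity (P (\bigcap_(l in [set` (f @: [set: 'I_K])%SET]) E l)).
  congr (P _); apply/seteqP; split=> w /= wv.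
    by move=> l /imsetP[j _ ->]; rewrite Ef.
  by move=> j i; have := wv (f j); rewrite Ef; apply; exact: imset_f.
rewrite Nind; last first.
  move=> l /imsetP[j _ ->]; rewrite Ef.
  pose G := \bigcup_(A in @rectangles R d) preimage_set_system setT (N (f j) A) measurable.
  (* Membership in the generated sigma-algebra is read as measurability, to intersect finitely many
     generators. *)
  change (@measurable _ (g_sigma_algebraType G) [set w | forall i, N (f j) (A i) w = v j i]).
  rewrite (_ : [set w | _] = \bigcap_i (N (f j) (A i) @^-1` [set v j i])).
    apply: fin_bigcap_measurable => [|i _]; first exact: finite_finset.
    apply: sub_sigma_algebra; exists (A i); first exact: rA.
    by exists [set v j i]; rewrite ?setTI.
  by apply/seteqP; split=> w /= wv i => [_|]; exact: wv.
rewrite big_imset /=; last by move=> i j _ _; exact: f_inj.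
by apply: eq_big => [j|j _]; rewrite ?inE // Ef.
Qed.

(** Serves both [PRF] and [GPRF], with [q] the mass function on one box. Conversely, the case of a
    single box recovers the marginals, and the product formula then yields independence. *)
Lemma independent_on_disjoint_joint_pmf (M : set (d.-tuple R) -> T -> nat)
    (q : ('I_d -> interval R) -> nat -> R) :
  (forall A, rectangles A -> measurable_fun setT (M A)) ->
  ((forall I, bounded_nonneg I -> forall n,
      P [set w | M (box I) w = n] = (q I n)%:E) /\
    independent_on_disjoint P M) <->
  (forall (m : nat) (I : 'I_m -> 'I_d -> interval R) (n : 'I_m -> nat),
    (forall i, bounded_nonneg (I i)) -> trivIset setT (fun i => box (I i)) ->
    P [set w | forall i, M (box (I i)) w = n i] =
    (\prod_(i < m) q (I i) (n i))%:E).
Proof.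
move=> mM; split=> [[Mq Mind] m I n bI tI|Mjoint].
  rewrite independent_rvs_joint_pmf.
    by rewrite -prodEFin; apply: eq_bigr => i _; rewrite Mq.
  apply: (Mind m (fun i => box (I i))) => [i|]; last exact: tI.
  by exists (I i) => //; exact: bI.
have Mq I : bounded_nonneg I -> forall n,
    P [set w | M (box I) w = n] = (q I n)%:E.
  move=> bI n; have := Mjoint 1%N (fun=> I) (fun=> n) (fun=> bI).
  rewrite big_ord1 => <-; last by move=> i j _ _ _; rewrite !ord1.
  by congr (P _); apply/seteqP; split=> w /= wn; [move=> _|exact: (wn ord0)].
split=> // m A rA tA.
have /choice[I IA] i : exists I, bounded_nonneg I /\ box I = A i.
  by have [I bI <-] := rA i; exists I.
have AE : A = fun i => box (I i) by apply/funext => i; rewrite (IA i).2.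
apply: independent_rvs_pmf => [i|n]; first exact: mM.
rewrite AE Mjoint -?AE // => [|i]; last exact: (IA i).1.
rewrite -prodEFin; apply: eq_bigr => i _.
by rewrite Mq //; exact: (IA i).1.
Qed.

(** Agrees with the mass in [GPRF] by unfolding [poisson_mass]. *)
Definition Theta_mass (K : nat) (lam : 'I_K -> R) (I : 'I_d -> interval R)
    (n : nat) : R :=
  \sum_(v \in Theta K n) \prod_(j < K) poisson_mass (lam j * volume I) (v j).

Lemma PRF_joint_pmf (lam : R) (M : set (d.-tuple R) -> T -> nat) :
  0 < lam -> random_measure M ->
  PRF P lam M <->
  (forall (m : nat) (I : 'I_m -> 'I_d -> interval R) (n : 'I_m -> nat),
    (forall i, bounded_nonneg (I i)) -> trivIset setT (fun i => box (I i)) ->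
    P [set w | forall i, M (box (I i)) w = n i] =
    (\prod_(i < m) poisson_mass (lam * volume (I i)) (n i))%:E).
Proof.
move=> lam0 Mrm.
have vol0 I : 0 <= lam * @volume R d I by rewrite mulr_ge0 ?volume_ge0 // ltW.
apply: iff_trans (independent_on_disjoint_joint_pmf
  (fun I => poisson_mass (lam * volume I)) Mrm.1).
split=> [[_ Mq Mind]|[Mq Mind]]; split=> // I bI.
  by move=> n; rewrite -poisson_prob_set1 // -Mq.
move=> U.
have mM : measurable_fun setT (M (box I)) by apply: Mrm.1; exists I.
apply: (@measure_preimage_nat_ext _ _ _ _ _ P
  (poisson_prob (lam * volume I) 0%N) _ id mM (@measurable_id _ _ _)) => n.
by rewrite [RHS]poisson_prob_set1 // -Mq.
Qed.

(** Each factor of the joint mass is a sum over [Theta], so [prod_Theta_mixture] turns the product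
    into a mixture, for any admissible [B]. *)
Lemma GPRF_joint_pmf (K : nat) (lam : 'I_K -> R)
    (M : set (d.-tuple R) -> T -> nat) :
  random_measure M ->
  GPRF P lam M <->
  (forall (m : nat) (I : 'I_m -> 'I_d -> interval R) (n : 'I_m -> nat) (B : nat),
    (forall i, bounded_nonneg (I i)) -> trivIset setT (fun i => box (I i)) ->
    (forall i, n i <= B)%N ->
    P [set w | forall i, M (box (I i)) w = n i] =
    (mixture B (fun j v =>
       \prod_(i < m) poisson_mass (lam j * volume (I i)) (v i)) n)%:E).
Proof.
move=> Mrm.
have Mjoint := independent_on_disjoint_joint_pmf (Theta_mass lam) Mrm.1.
have mixE m (I : 'I_m -> 'I_d -> interval R) n B (nB : forall i, (n i <= B)%N) :
    \prod_(i < m) Theta_mass lam (I i) (n i) = mixture B (fun j v =>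
      \prod_(i < m) poisson_mass (lam j * volume (I i)) (v i)) n :=
  prod_Theta_mixture (fun j i => poisson_mass (lam j * volume (I i))) nB.
split=> [[_ Mq Mind] m I n B bI tI nB|Mmix].
  by rewrite (Mjoint.1 (conj Mq Mind)) // (mixE _ _ _ B).
have [|Mq Mind] := Mjoint.2 _; last by split.
move=> m I n bI tI.
have nB i : (n i <= \sum_i n i)%N by rewrite (bigD1 i) //= leq_addr.
by rewrite (Mmix m I n _ bI tI nB) -mixE.
Qed.

End Fields.

Theorem theorem2p1 (dT : measure_display) (T : measurableType dT)
    (R : realType) (P : probability T R) (d k : nat)
    (hd : (1 <= d)%N) (hk : (1 <= k)%N)
    (lam : 'I_k -> R) (lam_gt0 : forall j, 0 < lam j)
    (N : 'I_k -> set (d.-tuple R) -> T -> nat)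
    (N_rm : forall j, random_measure (N j))
    (N_indep : independent_fields P N) :
  (forall (k' : nat) (k'_ge1 : (1 <= k')%N) (k'_le : (k' <= k)%N),
     GPRF P (fun j : 'I_k' => lam (widen_ord k'_le j))
       (fun A w => (\sum_(j < k') j.+1 * N (widen_ord k'_le j) A w)%N))
  <->
  (independent_fields P N /\ forall j, PRF P (lam j) (N j)).
Proof.
pose mass (m : nat) (I : 'I_m -> 'I_d -> interval R) (j : 'I_k)
  (v : 'I_m -> nat) := \prod_(i < m) poisson_mass (lam j * volume (I i)) (v i).
have widen_inj K (leKk : (K <= k)%N) : injective (widen_ord leKk).
  by move=> i j /(congr1 val) /= /val_inj.
have sum_rm K (leKk : (K <= k)%N) : random_measure
    (fun A w => (\sum_(j < K) j.+1 * N (widen_ord leKk j) A w)%N).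
  exact: (random_measure_sum (fun j : 'I_K => j.+1)).
have mN m (I : 'I_m -> 'I_d -> interval R) j i :
    (forall i, bounded_nonneg (I i)) -> measurable_fun setT (N j (box (I i))).
  by move=> bI; apply: (N_rm j).1; exists (I i) => //; exact: bI.
(* Independence of the fields makes the law of each partial sum a mixture of the joint laws [b j] of
   the single fields. *)
have mixN K (leKk : (K <= k)%N) m (I : 'I_m -> 'I_d -> interval R) B
    (b : 'I_K -> ('I_m -> nat) -> R) (n : 'I_m -> nat) :
    (forall i, bounded_nonneg (I i)) ->
    (forall j v, P [set w | forall i, N (widen_ord leKk j) (box (I i)) w = v i] =
      (b j v)%:E) ->
    (forall i, n i <= B)%N ->
    P [set w | forall i, (\sum_(j < K) j.+1 *
      N (widen_ord leKk j) (box (I i)) w)%N = n i] = (mixture B b n)%:E.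
  move=> bI Nb nB; apply: mixture_pmf => // [j i|v]; first exact: mN.
  rewrite (independent_fields_joint_pmf _ (widen_inj _ leKk)) //.
    by rewrite -prodEFin; apply: eq_bigr => j _.
  by move=> i; exists (I i) => //; exact: bI.
split=> [gprf|[_ prf] K _ leKk]; last first.
  (* (2) => (1): Poisson joint laws turn this mixture into the one characterising [GPRF]. *)
  apply/GPRF_joint_pmf => // m I n B bI tI nB; apply: mixN => // j v.
  by apply: (PRF_joint_pmf P (lam_gt0 _) (N_rm _)).1.
split=> // j; apply/PRF_joint_pmf => // m I n bI tI.
(* (1) => (2): for fixed boxes, strong induction on [j], for all value vectors [n] at once. *)
have [s] := ubnP j; elim: s j n => // s IHs j n; rewrite ltnS => js.
(* [ltn_ord j] reads [j.+1 <= k]: the partial sum used has [j.+1] terms, and its last index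
   [ord_max] is sent to [j]. *)
pose b l v :=
  fine (P [set w | forall i, N (widen_ord (ltn_ord j) l) (box (I i)) w = v i]).
have bE l v :
    P [set w | forall i, N (widen_ord (ltn_ord j) l) (box (I i)) w = v i] =
    (b l v)%:E.
  rewrite fineK //; apply: fin_num_measure.
  rewrite (_ : [set w | _] = \bigcap_i
      (N (widen_ord (ltn_ord j) l) (box (I i)) @^-1` [set v i])).
    apply: fin_bigcap_measurable => [|i _]; first exact: finite_finset.
    by apply: measurable_preimage_nat; exact: mN.
  by apply/seteqP; split=> w /= wv i => [_|]; exact: wv.
have jE : widen_ord (ltn_ord j) ord_max = j by exact/val_inj.
suff /(congr1 (@^~ n)) bmax : b ord_max = mass m I (widen_ord (ltn_ord j) ord_max).
  by rewrite -[X in N X]jE bE bmax /mass jE.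
apply: (@mixture_inj_last _ _ _ b (fun l => mass m I (widen_ord (ltn_ord j) l))).
- move=> l lmax; apply/funext => v; apply: EFin_inj; rewrite -bE.
  apply: IHs; rewrite /= (leq_trans _ js) // ltn_neqAle -ltnS ltn_ord andbT.
  by apply: contra lmax => /eqP lj; exact/eqP/val_inj.
- by move=> l; apply/prodf_neq0 => i _; exact: poisson_mass0_neq0.
(* Both mixtures are the law of this partial sum, once by independence of the fields and once by the
   [GPRF] hypothesis. *)
- move=> B u uB; apply: EFin_inj; rewrite -(mixN _ (ltn_ord j) m I B b u bI bE uB).
  exact: (GPRF_joint_pmf P _ (sum_rm _ (ltn_ord j))).1 (gprf _ _ _) _ _ _ _ bI tI uB.
Qed.
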